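(* There is a constant $C>0$ such that the random ordered $n$-matching $\mathcal{M}(\pi)$ asymptotically almost surely satisfies $$\overline{R}(\mathcal{M}(\pi))\geq C\left(\frac{n}{\log n}\right)^2.$$
   Context: All logarithms are base 2. An ordered graph is a pair $\mathcal{G}=(G,\prec)$ where $G$ is a (simple) graph and $\prec$ is a total ordering of its vertices. Two ordered graphs are isomorphic if there is a graph isomorphism between them preserving the vertex orderings. $\mathcal{K}_N$ denotes the (unique up to isomorphism) ordered complete graph on $N$ vertices. $\mathcal{G}=(G,\prec_1)$ is an ordered subgraph of $\mathcal{H}=(H,\prec_2)$ if $G$ is a subgraph of $H$ and $\prec_1$ is a suborder of $\prec_2$. The ordered Ramsey number $\overline{R}(\mathcal{G})$ is the minimum integer $N$ such that every $2$-coloring of the edges of $\mathcal{K}_N$ contains a monochromatic ordered subgraph isomorphic to $\mathcal{G}$. For a positive integer $n$, let $\pi$ be a permutation of $[n]=\{1,\dots,n\}$ chosen uniformly at random from all $n!$ permutations. The random ordered $n$-matching $\mathcal{M}(\pi)$ is the ordered matching with vertex set $[2n]$ (with the natural order) and with edges $\{i,n+\pi(i)\}$ for every $i\in[n]$. An event holds asymptotically almost surely if its probability tends to $1$ as $n\to\infty$. *)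

(* Defs.v *)
From mathcomp Require Import classical_sets.
From mathcomp Require Import all_boot all_order all_algebra all_fingroup.
From mathcomp Require Import boolp reals topology normedtype sequences exp.
Import numFieldNormedType.Exports.

Set Implicit Arguments.
Unset Strict Implicit.
Unset Printing Implicit Defensive.

Import Order.TTheory GRing.Theory Num.Theory.

(* The order [olt] is strict; only its restriction to [overt] is relevant. *)
Record ograph (T : finType) := OGraph {
  overt : {set T};
  oedges : {set {set T}};
  olt : rel T;
  oedgesP : forall e, e \in oedges -> e \subset overt /\ #|e| = 2;
  olt_irr : {in overt, irreflexive olt};
  olt_trans : {in overt & &, transitive olt};
  olt_total : {in overt &, forall x y, x != y -> olt x y || olt y x} }.

Definition oadj (T : finType) (G : ograph T) : rel T :=
  fun x y => [set x; y] \in oedges G.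

Definition oisomorphic (T U : finType) (G : ograph T) (H : ograph U) : Prop :=
  exists f : {x : T | x \in overt G} -> {y : U | y \in overt H},
    [/\ bijective f,
        forall x y, oadj H (val (f x)) (val (f y)) = oadj G (val x) (val y)
      & forall x y, olt H (val (f x)) (val (f y)) = olt G (val x) (val y)].

Definition osubgraph (T : finType) (G H : ograph T) : Prop :=
  [/\ overt G \subset overt H, oedges G \subset oedges H
    & {in overt G &, olt G =2 olt H}].

Section OrdinalGraphs.

Variables (N : nat) (V : {set 'I_N}) (E : {set {set 'I_N}}).
Hypothesis EV : forall e, e \in E -> e \subset V /\ #|e| = 2.

Let ltI : rel 'I_N := fun x y => x < y.

Fact ltI_irr : {in V, irreflexive ltI}.
Proof. by move=> x _; apply: ltnn. Qed.

Fact ltI_trans : {in V & &, transitive ltI}.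
Proof. by move=> y x z _ _ _; apply: ltn_trans. Qed.

Fact ltI_total : {in V &, forall x y, x != y -> ltI x y || ltI y x}.
Proof. by move=> x y _ _; rewrite -neq_ltn. Qed.

Definition ord_ograph : ograph 'I_N :=
  OGraph EV ltI_irr ltI_trans ltI_total.

End OrdinalGraphs.

Fact complete_edgesP (N : nat) (e : {set 'I_N}) :
  e \in [set e : {set 'I_N} | #|e| == 2] -> e \subset [set: 'I_N] /\ #|e| = 2.
Proof.
by rewrite inE => /eqP e2; split=> //; apply/subsetP => x; rewrite inE.
Qed.

Definition complete_ograph (N : nat) : ograph 'I_N :=
  ord_ograph (@complete_edgesP N).

(* A 2-colouring is a function on all sets of vertices; its values on sets
   that are not edges play no role. *)
Definition monochromatic (T : finType) (c : {set T} -> bool) (H : ograph T) :=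
  exists b : bool, forall e, e \in oedges H -> c e = b.

Definition oarrows (T : finType) (G : ograph T) (N : nat) : Prop :=
  forall c : {set 'I_N} -> bool,
    exists H : ograph 'I_N,
      [/\ osubgraph H (complete_ograph N), monochromatic c H
        & oisomorphic G H].



Lemma homogeneous_set (T : finType) (c : {set T} -> bool) (a b : nat)
    (S : {set T}) : 2 ^ (a + b) <= #|S| ->
  exists (A : {set T}) (k : bool),
    [/\ A \subset S, #|A| = (if k then a else b)
      & {in A &, forall x y, x != y -> c [set x; y] = k}].
Proof.
have [m] := ubnP (a + b).
elim: m a b S => // m IHm [|a] b S.
  move=> _ _; exists set0, true.
  by split=> [||x y]; rewrite ?sub0set ?cards0 ?inE.
case: b => [|b].
  move=> _ _; exists set0, false.
  by split=> [||x y]; rewrite ?sub0set ?cards0 ?inE.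
move=> ltm leS.
have /card_gt0P[x Sx] : 0 < #|S| by apply: leq_trans leS; rewrite expn_gt0.
pose P k := [set y in S :\ x | c [set x; y] == k].
have PS k : P k \subset S.
  by apply/subsetP => y; rewrite !inE => /andP[/andP[]].
have cardP : (#|P true| + #|P false|).+1 = #|S|.
  rewrite (cardsD1 x S) Sx /= add1n -(cardsID [set y | c [set x; y]] (S :\ x)).
  by congr (_ + _).+1; apply: eq_card => y; rewrite !inE;
     case: (c _); rewrite ?andbT ?andbF.
have ext k (A : {set T}) : A \subset P k ->
    {in A &, forall y z, y != z -> c [set y; z] = k} ->
    [/\ x |: A \subset S, #|x |: A| = #|A|.+1
      & {in x |: A &, forall y z, y != z -> c [set y; z] = k}].
  move=> AP homA; split.
  - by rewrite subUset sub1set Sx (subset_trans AP).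
  - rewrite cardsU1; case: (boolP (x \in A)) => // /(subsetP AP).
    by rewrite !inE eqxx.
  move=> y z /setU1P[->|Ay] /setU1P[->|Az] nyz.
  - by rewrite eqxx in nyz.
  - by have := subsetP AP _ Az; rewrite !inE => /andP[_ /eqP].
  - by have := subsetP AP _ Ay; rewrite !inE setUC => /andP[_ /eqP].
  - exact: homA.
have [leT|ltT] := leqP (2 ^ (a + b.+1)) #|P true|.
  have [||A [k [AP cA homA]]] := IHm a b.+1 (P true); rewrite // .
  case: k cA homA => cA homA.
    have [? cxA ?] := ext true A AP homA.
    by exists (x |: A), true; rewrite cxA cA.
  by exists A, false; split=> //; apply: subset_trans (PS true).
have leF : 2 ^ (a.+1 + b) <= #|P false|.
  move: leS; rewrite -cardP addSn expnS mul2n -addnn -addSnnS in ltT * => leS.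
  by rewrite -(leq_add2l (2 ^ (a.+1 + b))); apply: leq_trans leS _;
     rewrite -addSn leq_add2r.
have [||A [k [AP cA homA]]] := IHm a.+1 b (P false); rewrite // .
  by rewrite -addSnnS in ltm.
case: k cA homA => cA homA.
  by exists A, true; split=> //; apply: subset_trans (PS false).
have [? cxA ?] := ext false A AP homA.
by exists (x |: A), false; rewrite cxA cA.
Qed.

Lemma rank_bij (T : finType) (G : ograph T) (n : nat) : #|overt G| = n ->
  exists r : {x : T | x \in overt G} -> 'I_n,
    bijective r /\ forall x y, (r x < r y) = olt G (val x) (val y).
Proof.
move=> cV.
pose rk (x : T) := #|[set y in overt G | olt G y x]|.
have rk_lt x y : x \in overt G -> y \in overt G -> olt G x y -> rk x < rk y.
  move=> Vx Vy xy; apply/proper_card/properP; split.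
    apply/subsetP => z; rewrite !inE => /andP[Vz zx].
    by rewrite Vz; apply: (olt_trans Vx Vz Vy zx xy).
  by exists x; rewrite !inE ?Vx ?xy // (olt_irr Vx).
have rkE x y : x \in overt G -> y \in overt G -> (rk x < rk y) = olt G x y.
  move=> Vx Vy; apply/idP/idP; last exact: rk_lt.
  have [->|nxy] := eqVneq x y; first by rewrite ltnn.
  case/orP: (olt_total Vx Vy nxy) => // /(rk_lt _ _ Vy Vx) lt1 lt2.
  by have := ltn_trans lt1 lt2; rewrite ltnn.
have rkV x : x \in overt G -> rk x < n.
  move=> Vx; rewrite -cV; apply/proper_card/properP; split.
    by apply/subsetP => z; rewrite !inE => /andP[].
  by exists x; rewrite // !inE Vx (olt_irr Vx).
exists (fun x => Ordinal (rkV _ (valP x))); split; last first.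
  by move=> x y /=; apply: rkE; apply: valP.
apply: inj_card_bij => [x y [] rxy|]; last by rewrite card_ord card_sig -cV.
apply/val_inj/eqP/negPn/negP => nxy.
by case/orP: (olt_total (valP x) (valP y) nxy) => /rk_lt;
  rewrite rxy ltnn => H; have := H (valP _) (valP _).
Qed.

Lemma oarrows_exists (T : finType) (G : ograph T) : exists N, oarrows G N.
Proof.
pose n := #|overt G|; exists (2 ^ (n + n)) => c.
have [|A [b [_ cA homA]]] := homogeneous_set c (a := n) (b := n) (S := setT).
  by rewrite cardsT card_ord.
have {}cA : #|A| = n by rewrite cA if_same.
have [r [[r' rK r'K] rE]] := rank_bij (erefl n : #|overt G| = n).
have E0 (e : {set 'I_(2 ^ (n + n))}) : e \in set0 -> e \subset A /\ #|e| = 2.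
  by rewrite inE.
have [q [[q' qK q'K] qE]] := rank_bij (cA : #|overt (ord_ograph E0)| = n).
pose f x : {y | y \in A} := q' (r x); pose g y := r' (q y).
have fK : cancel f g by move=> x; rewrite /g q'K rK.
have gK : cancel g f by move=> x; rewrite /f r'K qK.
pose pre (e : {set 'I_(2 ^ (n + n))}) : {set T} :=
  [set val (g y) | y in [set y | val y \in e]].
pose E := [set e : {set 'I_(2 ^ (n + n))} |
            (e \subset A) && (pre e \in oedges G)].
have EA e : e \in E -> e \subset A /\ #|e| = 2.
  rewrite inE => /andP[eA /oedgesP[_ pe2]]; split=> //; rewrite -[RHS]pe2.
  rewrite /pre card_imset; last exact: inj_comp val_inj (can_inj gK).
  rewrite -(card_imset _ val_inj); apply: eq_card => y.
  apply/idP/imsetP => [ye|[z]]; last by rewrite inE => ze ->.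
  by exists (exist _ y (subsetP eA _ ye)); rewrite ?inE.
exists (ord_ograph EA); split.
- split=> //=.
  by apply/subsetP => e /EA[_ e2]; rewrite inE e2.
- exists b => e /= /EA[eA /eqP/cards2P[y [z [nyz def_e]]]].
  by rewrite def_e in eA *; apply: homA => //; apply: (subsetP eA);
     rewrite !inE eqxx ?orbT.
exists f; split; first exact: Bijective fK gK.
  move=> x y; rewrite /oadj /= inE subUset !sub1set !(valP (f _)) /=.
  suff -> : pre [set val (f x); val (f y)] = [set val x; val y] by [].
  apply/setP => z; apply/imsetP/set2P => [[w]|].
    by rewrite !inE !val_eqE => /orP[] /eqP-> ->; rewrite fK; [left|right].
  by case=> ->; [exists (f x)|exists (f y)]; rewrite ?fK // !inE eqxx ?orbT.
by move=> x y; rewrite -[RHS]rE -[LHS]qE !q'K.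
Qed.

Fact oarrowsb_exists (T : finType) (G : ograph T) :
  exists N, (fun N => `[< oarrows G N >]) N.
Proof. by have [N GN] := oarrows_exists G; exists N; apply/asboolP. Qed.

Definition oramsey (T : finType) (G : ograph T) : nat :=
  ex_minn (oarrowsb_exists G).

(* With indices counted from 0, the vertices [2n] are 'I_(n + n), and the
   edge {i, n + s i} is {lshift n i, rshift n (s i)}. *)
Definition matching_edges (n : nat) (s : 'S_n) : {set {set 'I_(n + n)}} :=
  [set [set lshift n i; rshift n (s i)] | i : 'I_n].

Fact matching_edgesP (n : nat) (s : 'S_n) (e : {set 'I_(n + n)}) :
  e \in matching_edges s -> e \subset [set: 'I_(n + n)] /\ #|e| = 2.
Proof.
case/imsetP => i _ ->; split; first by apply/subsetP => x; rewrite inE.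
by rewrite cards2 eq_lrshift.
Qed.

Definition omatching (n : nat) (s : 'S_n) : ograph 'I_(n + n) :=
  ord_ograph (@matching_edgesP n s).

Local Open Scope ring_scope.

Definition uniform_Pr (R : realType) (T : finType) (A : {set T}) : R :=
  #|A|%:R / #|T|%:R.

Definition aas (R : realType) (T : nat -> finType)
    (A : forall n, {set T n}) : Prop :=
  ((fun n => uniform_Pr R (A n)) @ \oo --> (1 : R))%classic.

Definition log2 (R : realType) (x : R) : R := ln x / ln 2.

(* Main.v *)
Require Import Defs.
From mathcomp Require Import all_boot all_order all_algebra all_fingroup.
From mathcomp Require Import boolp reals topology normedtype sequences exp.
From mathcomp Require Import zify.

(* Cut [N] into m ~ n / log n intervals of length t ~ n / log n and colour the
   edges between two intervals alike, by a random m x m matrix c. With positive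
   probability no square submatrix of c of size k ~ log n has 3/4 of its entries
   of one colour. A monochromatic copy of M(pi) yields monotone maps
   f, g : [n] -> [m] with fibres of size at most t (the intervals of the left
   and of the right vertices) such that c(f i, g (pi i)) does not depend on i.
   As n / (2 t) >= k, a linear number of rows i admit at most 7n/8 columns j
   with (f i, g j) of the prescribed colour, so a random pi satisfies this with
   probability exponentially small in n, whereas there are at most (n+1)^(2m)
   pairs (f, g), which is 2^(eps n) with a small eps if m log n / n is small. *)

Set Implicit Arguments.
Unset Strict Implicit.
Unset Printing Implicit Defensive.

(** * Union bound and subsets of prescribed size *)

Lemma union_bound (T I : finType) (B : {set T}) (P : {set I})
    (F : I -> {set T}) (M : nat) :
  (forall x, x \in B -> exists2 i, i \in P & x \in F i) ->
  (forall i, i \in P -> #|F i| <= M) -> #|B| <= #|P| * M.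
Proof.
move=> BF FM; rewrite -sum_nat_const.
apply: (@leq_trans (\sum_(i in P) #|F i|)); last exact: leq_sum.
rewrite -sum1_card.
under [X in _ <= X]eq_bigr do rewrite -sum1_card big_mkcond /=.
rewrite exchange_big /= big_mkcond; apply: leq_sum => x _.
by case: ifP => // /BF[i Pi Fi]; rewrite (bigD1 i) //= Fi.
Qed.

Lemma subset_of_card (T : finType) (A : {set T}) (k : nat) :
  k <= #|A| -> exists2 B : {set T}, B \subset A & #|B| = k.
Proof.
move=> /card_geqP[s [us <- sA]]; exists [set x in s].
  by apply/subsetP => x; rewrite inE => /sA.
by rewrite cardsE; apply/card_uniqP.
Qed.

(** * A matrix without biased square submatrices *)

(** Each point decides independently whether to lie in [S]; a point of [Z] contributes a factor 2 +
    1, any other point 1 + 1. *)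
Lemma sum_exp_cardI (T : finType) (Z : {set T}) :
  \sum_(S : {set T}) 2 ^ #|S :&: Z| = 3 ^ #|Z| * 2 ^ #|~: Z|.
Proof.
have pE (x : nat) (A B : {set T}) :
    \prod_i (if i \in A then if i \in B then x else 1 else 1) = x ^ #|A :&: B|.
  rewrite -prod_nat_const [RHS]big_mkcond; apply: eq_bigr => i _.
  by rewrite inE; do 2 case: (_ \in _).
under eq_bigr do rewrite -pE.
transitivity (\prod_(i : T) ((if i \in Z then 2 else 1) + 1)).
  by rewrite bigA_distr.
have -> : 3 ^ #|Z| = \prod_(i : T) (if i \in Z then 3 else 1).
  by rewrite -prod_nat_const [LHS]big_mkcond.
have -> : 2 ^ #|~: Z| = \prod_(i : T) (if i \in Z then 1 else 2).
  rewrite -prod_nat_const [LHS]big_mkcond; apply: eq_bigr => i _.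
  by rewrite inE; case: (_ \in _).
by rewrite -big_split; apply: eq_bigr => i _; case: (_ \in _).
Qed.

(* Markov's inequality for the weights of [sum_exp_cardI], and 3^8 2 <= 2^14. *)
Lemma card_dense_subsets (T : finType) (Z : {set T}) (v : nat) :
  #|Z| = 8 * v ->
  #|[set S : {set T} | 6 * v <= #|S :&: Z|]| * 2 ^ v <= 2 ^ #|T|.
Proof.
move=> cZ; set D := [set S | _].
have : #|D| * 2 ^ (6 * v) <= 3 ^ #|Z| * 2 ^ #|~: Z|.
  rewrite -sum_exp_cardI -sum_nat_const [X in X <= _]big_mkcond.
  apply: leq_sum => S _; case: ifP => //.
  by rewrite inE => /leq_pexp2l ->.
have <- : #|Z| + #|~: Z| = #|T| by rewrite cardsC.
rewrite cZ expnD !expnM.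
have : 3 ^ 8 * 2 <= 2 ^ 8 * 2 ^ 6 by [].
move: #|D| (2 ^ #|_|) (3 ^ 8) (2 ^ 8) => d r a b.
have : 0 < 2 ^ 6 by [].
move: (2 ^ 6) => c c0 le_abc le1.
have le2 : a ^ v * 2 ^ v <= b ^ v * c ^ v.
  by rewrite -!expnMn; case: (v) => // u; rewrite leq_exp2r.
have cv0 : 0 < c ^ v by rewrite expn_gt0 c0.
rewrite -(leq_pmul2r cv0) mulnAC.
apply: leq_trans (leq_mul le1 (leqnn (2 ^ v))) _.
by rewrite mulnAC [X in _ <= X]mulnAC leq_mul2r le2 orbT.
Qed.

Lemma bin_leq_exp (n k : nat) : 'C(n, k) <= n ^ k.
Proof.
have : 'C(n, k) <= n ^_ k by rewrite -bin_ffact leq_pmulr ?fact_gt0.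
by move/leq_trans; apply; rewrite ffact_prod -[k in _ <= n ^ k]card_ord
  -prod_nat_const; apply: leq_prod => i _; apply: leq_subr.
Qed.

Lemma unbiased_matrix (m w L : nat) : m <= 2 ^ L -> 4 * L < w ->
  exists c : {set 'I_m * 'I_m}, forall X Y : {set 'I_m},
    #|X| = 4 * w -> #|Y| = 4 * w ->
    (#|c :&: setX X Y| < 12 * w ^ 2) && (#|~: c :&: setX X Y| < 12 * w ^ 2).
Proof.
move=> mL Lw; pose D := [set X : {set 'I_m} | #|X| == 4 * w].
pose F (i : {set 'I_m} * {set 'I_m} * bool) :=
  [set c : {set 'I_m * 'I_m} |
    12 * w ^ 2 <= #|(if i.2 then c else ~: c) :&: setX i.1.1 i.1.2|].
have [/existsP[c /forallP cP]|/existsPn noc] :=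
    boolP [exists c, forall i, (i.1 \in setX D D) ==> (c \notin F i)].
  exists c => X Y cX cY.
  have P b : c \notin F (X, Y, b).
    by apply: (implyP (cP _)); rewrite !inE /= cX cY !eqxx.
  by move: (P true) (P false); rewrite !inE -!ltnNge => -> ->.
have FM i : i \in setX (setX D D) setT -> #|F i| <= 2 ^ (m * m - 2 * w ^ 2).
  case: i => [[X Y] b]; rewrite !inE /= andbT => /andP[/eqP cX /eqP cY].
  (* With v = 2w^2 the threshold 6v of [card_dense_subsets] is 12w^2, three quarters of the 16w^2
     cells. *)
  have cZ : #|setX X Y| = 8 * (2 * w ^ 2) by rewrite cardsX cX cY; lia.
  have := card_dense_subsets cZ; rewrite card_prod card_ord => le1.
  have le2 : 2 * w ^ 2 <= m * m.
    have := max_card (mem (setX X Y)); rewrite cZ card_prod card_ord; lia.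
  rewrite -(@leq_pmul2r (2 ^ (2 * w ^ 2))) ?expn_gt0 // -expnD subnK //.
  apply: leq_trans le1; rewrite leq_mul2r mulnA /F /=.
  case: b; first by rewrite leqnn orbT.
  rewrite -(card_imset _ (can_inj (@setCK _))); apply/orP; right.
  apply/subset_leq_card/subsetP => _ /imsetP[c + ->].
  by rewrite !inE.
have : #|[set: {set 'I_m * 'I_m}]| <=
    #|setX (setX D D) [set: bool]| * 2 ^ (m * m - 2 * w ^ 2).
  apply: (@union_bound _ _ _ _ F) => [c _|i Pi]; last exact: FM.
  have := noc c; rewrite negb_forall => /existsP[[[X Y] b]].
  rewrite negb_imply negbK => /andP[P Fc].
  by exists (X, Y, b); rewrite // !inE in P *; rewrite P.
rewrite -powersetT card_powerset !cardsT !cardsX cardsT card_bool card_prod.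
rewrite card_draws card_ord => leT; exfalso.
have [ltm|lem] := ltnP m (4 * w).
  by rewrite bin_small // in leT; move: leT; rewrite leqNgt expn_gt0.
have le2 : 2 * w ^ 2 <= m * m by nia.
have leC : 'C(m, 4 * w) <= 2 ^ (L * (4 * w)).
  apply: leq_trans (bin_leq_exp _ _) _.
  by rewrite [2 ^ _]expnM leq_exp2r //; lia.
have : 2 ^ (m * m) <= 2 ^ (L * (4 * w) + L * (4 * w) + 1 + (m * m - 2 * w ^ 2)).
  by rewrite !expnD; apply: leq_trans leT _; rewrite leq_mul2r !leq_mul ?orbT.
rewrite leq_exp2l //; nia.
Qed.

(** * Permutations with restricted values *)

(** Multiplying by the inverse of one fixed member [s0] injects the set into the permutations that
    fix [R] pointwise. *)
Lemma card_perm_agree (T : finType) (R : {set T}) (h : T -> T) :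
  #|[set s : {perm T} | [forall i in R, s i == h i]]| <= (#|~: R|)`!.
Proof.
set A := [set s | _].
have [->|[s0 As0]] := set_0Vmem A; first by rewrite cards0.
rewrite -card_perm -(card_imset (mem A) (mulIg s0^-1)%g).
apply/subset_leq_card/subsetP => _ /imsetP[s As ->].
move: As As0; rewrite !inE => /'forall_in_eqP As /'forall_in_eqP As0.
apply/subsetP => i; rewrite !inE permM; apply: contraNN => Ri.
by rewrite As // -As0 // permK.
Qed.

Lemma card_perm_rows (T : finType) (R : {set T}) (W : T -> {set T}) (d : nat) :
  {in R, forall i, #|W i| <= d} ->
  #|[set s : {perm T} | [forall i, s i \in W i]]| <= d ^ #|R| * (#|~: R|)`!.
Proof.
(* The singletons outside [R] make [family V] count only the choices of values on [R];
   [card_perm_agree] bounds the extensions of each choice. *)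
move=> Wd; pose V i := if i \in R then W i else [set i].
apply: (@leq_trans (#|[set h : {ffun T -> T} in family V]| * (#|~: R|)`!)).
  apply: (@union_bound _ {ffun T -> T} _ _
      (fun h => [set s : {perm T} | [forall i in R, s i == h i]])).
    move=> s; rewrite inE => /forallP sW.
    exists [ffun i => if i \in R then s i else i].
      rewrite inE; apply/familyP => i; rewrite ffunE /V.
      by case: ifP; rewrite ?inE.
    by rewrite inE; apply/'forall_in_eqP => i Ri; rewrite ffunE Ri.
  by move=> h _; apply: card_perm_agree.
rewrite leq_mul2r; apply/orP; right.
rewrite cardsE card_family foldrE big_image /= -prod_nat_const.
rewrite [X in _ <= X]big_mkcond; apply: leq_prod => i _ /=.
by rewrite /V; case: ifP => [/Wd //|_]; rewrite cards1.
Qed.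

(** * Counting monotone maps *)

Lemma card_ord_ltn (n i : nat) : i <= n -> #|[set j : 'I_n | j < i]| = i.
Proof.
move=> le_in.
by rewrite -sum1dep_card (big_ord_narrow le_in) sum1_card card_ord.
Qed.

(** A monotone map is recovered from the sizes of the m sets where it lies below p, each size being
    one of 0, ..., n. *)
Lemma card_monotone (n m : nat) :
  #|[set f : {ffun 'I_n -> 'I_m} |
      [forall i : 'I_n, forall j : 'I_n, (i <= j) ==> (f i <= f j)]]|
    <= n.+1 ^ m.
Proof.
have lt_card (A : {set 'I_n}) : #|A| < n.+1.
  by rewrite ltnS -[n in _ <= n]card_ord max_card.
pose h (f : {ffun 'I_n -> 'I_m}) : {ffun 'I_m -> 'I_n.+1} :=
  [ffun p : 'I_m => Ordinal (lt_card [set i | f i < p])].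
set M := [set f | _].
(* By monotonicity the set counted by [h f p] is an initial segment, so its size locates the first
   index with value at least p. *)
have hE f (i : 'I_n) (p : 'I_m) : f \in M -> (h f p <= i) = (p <= f i).
  rewrite inE => /forallP fM; have {}fM (j k : 'I_n) : j <= k -> f j <= f k.
    by apply/implyP; move: (fM j) => /forallP.
  rewrite ffunE /=; apply/idP/idP => [|le_p].
    apply: contraTT; rewrite -!ltnNge => lt_p.
    have : #|[set j : 'I_n | j <= i]| <= #|[set j | f j < p]|.
      apply/subset_leq_card/subsetP => j; rewrite !inE => /fM.
      by move=> /leq_ltn_trans; apply.
    by apply: leq_trans; rewrite (card_ord_ltn (ltn_ord i)).
  apply: (@leq_trans #|[set j : 'I_n | j < i]|).
    apply/subset_leq_card/subsetP => j; rewrite !inE => lt_p.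
    rewrite ltnNge; apply/negP => /fM.
    by rewrite leqNgt (leq_trans lt_p le_p).
  by rewrite card_ord_ltn // ltnW.
have inj_h : {in M &, injective h}.
  move=> f g Mf Mg fg; apply/ffunP => i; apply/val_inj/eqP.
  have E (p : 'I_m) : (p <= f i) = (p <= g i) by rewrite -!hE // fg.
  by rewrite eqn_leq -E leqnn E leqnn.
rewrite -(card_in_imset inj_h); apply: leq_trans (max_card _) _.
by rewrite card_ffun !card_ord.
Qed.

(** * Sparse rows of a blown-up matrix *)

Lemma card_imset_fibers (T U : finType) (f : T -> U) (D : {set T}) (t : nat) :
  (forall u, #|[set x | f x == u]| <= t) -> #|D| <= #|f @: D| * t.
Proof.
move=> ft.
apply: (@union_bound _ _ _ _ (fun u => [set x | f x == u])) => // x Dx.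
by exists (f x); rewrite ?imset_f ?inE.
Qed.

(** Double counting: if too few rows were sparse, the others would supply k matrix rows [X];
    averaging over columns, at least n/2 of them would have degree at least 3k/4 into [X] and would
    supply [Y] with [setX X Y] too dense. *)
Lemma sparse_rows (n m t k : nat) (f g : 'I_n -> 'I_m) (c : {set 'I_m * 'I_m}) :
  (forall p, #|[set i | f i == p]| <= t) ->
  (forall p, #|[set j | g j == p]| <= t) ->
  2 * k * t <= n ->
  (forall X Y : {set 'I_m}, #|X| = k -> #|Y| = k ->
     4 * #|c :&: setX X Y| < 3 * k ^ 2) ->
  n <= 16 * #|[set i | 8 * #|[set j | (f i, g j) \in c]| <= 7 * n]|.
Proof.
move=> ft gt kt cP; set A := [set i | _]; rewrite leqNgt; apply/negP => ltA.
have n0 : 0 < n by apply: leq_ltn_trans ltA.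
have t0 : 0 < t.
  apply: leq_trans (ft (f (Ordinal n0))).
  by apply/card_gt0P; exists (Ordinal n0); rewrite inE.
have k0 : 0 < k.
  rewrite lt0n; apply/negP => /eqP k0; have := cP set0 set0.
  by rewrite cards0 k0 muln0 => /(_ erefl erefl).
(* At least n/2 indices take at least n/(2t) >= k values. *)
have large (h : 'I_n -> 'I_m) (D : {set 'I_n}) :
    (forall p, #|[set i | h i == p]| <= t) -> n <= 2 * #|D| ->
    exists2 X : {set 'I_m}, X \subset h @: D & #|X| = k.
  move=> ht leD; apply: subset_of_card.
  rewrite -(leq_pmul2r t0); apply: leq_trans (card_imset_fibers _ ht).
  by rewrite -(@leq_pmul2l 2) // mulnA (leq_trans kt).
have leA : n <= 2 * #|~: A|.
  by have := cardsC A; rewrite card_ord; move: ltA; lia.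
have [X /subsetP XA cX] := large f (~: A) ft leA.
pose deg q := #|[set p in X | (p, q) \in c]|.
pose B := [set j | 3 * k <= 4 * deg (g j)].
have sumE : \sum_j deg (g j) = \sum_(p in X) #|[set j | (p, g j) \in c]|.
  rewrite /deg; under eq_bigr do rewrite -sum1dep_card big_mkcondr.
  rewrite exchange_big; apply: eq_bigr => p _.
  by rewrite -big_mkcond sum1dep_card.
have lb : k * (7 * n) <= \sum_j 8 * deg (g j).
  rewrite -big_distrr sumE big_distrr -cX -sum_nat_const.
  apply: leq_sum => p Xp.
  have /imsetP[i + ->] := XA _ Xp.
  by rewrite !inE -ltnNge => /ltnW.
have ub : \sum_j 8 * deg (g j) <= #|B| * (8 * k) + #|~: B| * (6 * k).
  rewrite -!sum_nat_const (bigID (mem B)) /=; apply: leq_add.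
    apply: leq_sum => j _; rewrite leq_mul2l -cX.
    apply/subset_leq_card/subsetP => p.
    by rewrite inE => /andP[].
  under [X in _ <= X]eq_bigl do rewrite inE.
  apply: leq_sum => j; rewrite inE; lia.
(* After dividing by k, the two bounds say 7n <= 8b + 6(n - b) with b = [#|B|]. *)
have leB : n <= 2 * #|B|.
  have := leq_trans lb ub.
  rewrite ![_ * (_ * k)]mulnA -mulnDl mulnC leq_pmul2r //.
  by have := cardsC B; rewrite card_ord; lia.
have [Y /subsetP YB cY] := large g B gt leB.
have := cP X Y cX cY; rewrite ltnNge => /negP; apply.
have -> : #|c :&: setX X Y| = \sum_(q in Y) deg q.
  rewrite -sum1_card; under [RHS]eq_bigr do rewrite /deg -sum1dep_card.
  rewrite (exchange_big_dep (mem X)) /=; last by move=> q p _ /andP[].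
  rewrite (pair_big_dep (mem X) (fun p q =>
    (q \in Y) && ((p \in X) && ((p, q) \in c))) (fun _ _ => 1)) /=.
  apply: eq_bigl => -[p q]; rewrite !inE /=.
  by case: (_ \in c); case: (_ \in X); case: (_ \in Y).
rewrite big_distrr -mulnn mulnCA -cY -sum_nat_const cY; apply: leq_sum => q Yq.
by have /imsetP[j + ->] := YB _ Yq; rewrite inE.
Qed.

(** * Random permutations against sparse rows *)

(** Bernoulli's inequality for (1 + x/d)^k, cleared of denominators. *)
Lemma bernoulli_exp (d x k : nat) : (d + k * x) * d ^ k <= d * (d + x) ^ k.
Proof.
elim: k => [|k IHk]; first by rewrite mul0n addn0 !expn0.
rewrite !expnS [X in _ <= X]mulnCA.
by apply: leq_trans (leq_mul (leqnn (d + x)) IHk); nia.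
Qed.

(** Bernoulli's inequality with x = e - d, where the hypothesis reads d <= k x. *)
Lemma double_exp (d e k : nat) :
  0 < k -> k.+1 * d <= k * e -> 2 * d ^ k <= e ^ k.
Proof.
move=> k0 de; have [->|d0] := posnP d; first by rewrite exp0n.
have led : d <= e by nia.
rewrite -(leq_pmul2l d0) -(subnKC led).
by apply: leq_trans (bernoulli_exp _ _ _); rewrite mulnA leq_mul2r; nia.
Qed.

(* Choose the images of 28 q of the sparse rows first: while they are exposed at
   least 15n/16 columns are free and at most 7n/8 are allowed, and
   (15/14)^14 >= 2. *)
Lemma card_perm_sparse (T : finType) (W : T -> {set T}) (q : nat) :
  512 * q <= #|T| -> #|T| <= 16 * #|[set i | 8 * #|W i| <= 7 * #|T|]| ->
  #|[set s : {perm T} | [forall i, s i \in W i]]| * 2 ^ (2 * q) <= #|T|`!.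
Proof.
move=> qn nA.
have [|R /subsetP RA cR] :=
  @subset_of_card _ [set i | 8 * #|W i| <= 7 * #|T|] (28 * q).
  by move: (leq_trans qn nA); lia.
pose d := 7 * #|T| %/ 8; pose e := #|T| - 28 * q.
have cRC : #|~: R| = e by rewrite /e -cR -(cardsC R) addKn.
have le28 : 28 * q <= #|T| by lia.
have le15 : 15 * d <= 14 * e by rewrite /d /e; lia.
(* The 28q exposures form 2q blocks of 14, and each block gains a factor 2. *)
have le2 : (d ^ 14 * 2) ^ (2 * q) <= (e ^ 14) ^ (2 * q).
  by have [->//|q0] := posnP q; rewrite leq_exp2r ?muln_gt0 // mulnC double_exp.
have Wd : {in R, forall i, #|W i| <= d}.
  by move=> i /RA; rewrite inE /d; lia.
apply: leq_trans (leq_mul (card_perm_rows Wd) (leqnn _)) _.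
(* Splitting the factorial of [#|T|] cancels that of e and leaves 28q falling factors, each at least
   e. *)
rewrite cR cRC -(ffact_fact le28) -/e mulnAC leq_mul2r; apply/orP; right.
have -> : 28 * q = 14 * (2 * q) by lia.
rewrite expnM -expnMn; apply: leq_trans le2 _.
rewrite -expnM ffact_prod -[X in e ^ X]card_ord -prod_nat_const.
by apply: leq_prod => i _; have := ltn_ord i; rewrite /e; lia.
Qed.

(** * From monochromatic copies to monotone maps *)

Lemma oarrows_matching (n m t N : nat) (s : 'S_n) (c : {set 'I_m * 'I_m}) :
  N <= m * t -> oarrows (omatching s) N ->
  exists (f g : {ffun 'I_n -> 'I_m}) (b : bool),
    [/\ {homo f : i j / i <= j}, {homo g : i j / i <= j},
        forall p, #|[set i | f i == p]| <= t,
        forall p, #|[set i | g i == p]| <= t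
      & forall i, ((f i, g (s i)) \in c) = b].
Proof.
move=> Nmt arr.
have blkP (x : 'I_N) : x %/ t < m.
  have := leq_trans (ltn_ord x) Nmt; case: (t) => [|u]; first by rewrite muln0.
  by rewrite ltn_divLR.
pose blk x := Ordinal (blkP x).
(* [c] need not be symmetric: the smaller endpoint selects the row. In a copy of the matching this
   is the left endpoint. *)
pose col (e : {set 'I_N}) :=
  [exists x : 'I_N, exists y : 'I_N,
    [&& x < y, e == [set x; y] & (blk x, blk y) \in c]].
have colE (x y : 'I_N) : x < y -> col [set x; y] = ((blk x, blk y) \in c).
  move=> xy; apply/existsP/idP => [[x' /existsP[y' /and3P[xy' /eqP E cE]]]|cxy].
    have /set2P Ex : x' \in [set x; y] by rewrite E !inE eqxx.
    have /set2P Ey : y' \in [set x; y] by rewrite E !inE eqxx orbT.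
    move: xy' cE; case: Ex => ->; case: Ey => ->; rewrite ?ltnn // => yx.
    by have := ltn_trans xy yx; rewrite ltnn.
  by exists x; apply/existsP; exists y; rewrite xy eqxx.
have [H [[/= _ _ Hlt] [b monoH] [F [_ FE Flt]]]] := arr col.
pose emb v : {x | x \in overt (omatching s)} := exist _ v (in_setT v).
pose phi (v : 'I_(n + n)) : 'I_N := val (F (emb v)).
have phi_lt (u v : 'I_(n + n)) : (phi u < phi v) = (u < v).
  by have := Flt (emb u) (emb v); rewrite Hlt ?(valP (F _)).
have phi_le (u v : 'I_(n + n)) : (phi u <= phi v) = (u <= v).
  by rewrite leqNgt phi_lt -leqNgt.
have phi_inj : injective phi.
  by move=> u v uv; apply/val_inj/eqP; rewrite eqn_leq -!phi_le uv leqnn.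
have fib (h : 'I_n -> 'I_(n + n)) p : injective h ->
    #|[set i | blk (phi (h i)) == p]| <= t.
  move=> h_inj; have hI := inj_comp phi_inj h_inj.
  have [t0|t0] := posnP t.
    rewrite leqNgt t0; apply/negP => /card_gt0P[i _].
    by have := leq_trans (ltn_ord (phi (h i))) Nmt; rewrite t0 muln0.
  (* Vertices of one block are told apart by their residues modulo t. *)
  pose r i : 'I_t := Ordinal (ltn_pmod (phi (h i)) t0).
  rewrite -(@card_in_imset _ _ r) => [|i j].
    by rewrite -[t in _ <= t]card_ord max_card.
  rewrite !inE => /eqP bi /eqP bj [rij]; apply/hI/val_inj.
  have [bij] : blk (phi (h i)) = blk (phi (h j)) by rewrite bi bj.
  by rewrite /= (divn_eq (phi (h i)) t) rij bij -divn_eq.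
exists [ffun i => blk (phi (lshift n i))].
exists [ffun i => blk (phi (rshift n i))], b.
split=> [i j ij|i j ij|p|p|i].
- by rewrite !ffunE /= leq_div2r // phi_le.
- by rewrite !ffunE /= leq_div2r // phi_le /= leq_add2l.
- by under eq_finset do rewrite ffunE; apply: fib; apply: lshift_inj.
- by under eq_finset do rewrite ffunE; apply: fib; apply: rshift_inj.
rewrite !ffunE -colE ?phi_lt /=; last first.
  by rewrite (leq_trans (ltn_ord i)) ?leq_addr.
apply: monoH.
have := FE (emb (lshift n i)) (emb (rshift n (s i))).
rewrite /oadj /= => ->; apply/imsetP; by exists i.
Qed.

(** There are at most 2 * 2^q triples of two maps and a colour, and each is compatible with at most
    a fraction 2^(-2q) of the permutations. *)
Lemma few_small_oramsey (n q m t L : nat) :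
  0 < L -> n < 2 ^ L -> 512 * q <= n -> 2 * (L * m) <= q -> 40 * L * t <= n ->
  #|[set s : 'S_n | oramsey (omatching s) <= m * t]| * 2 ^ q <= 2 * n`!.
Proof.
move=> L0 nL qn mq tn.
have mL : m <= 2 ^ L by nia.
(* w = 5L exceeds 4L; submatrices have size k = 4w = 20L, so 40Lt <= n is the condition 2kt <= n of
   [sparse_rows]. *)
have [c cP] := @unbiased_matrix m (5 * L) L mL ltac:(lia).
pose M := [set f : {ffun 'I_n -> 'I_m} |
  [forall i : 'I_n, forall j : 'I_n, (i <= j) ==> (f i <= f j)]
  && [forall p, #|[set i | f i == p]| <= t]].
pose W (x : {ffun 'I_n -> 'I_m} * {ffun 'I_n -> 'I_m} * bool) i :=
  [set j | (x.1.1 i, x.1.2 j) \in if x.2 then c else ~: c].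
have cM : #|M| <= 2 ^ (L * m).
  apply: (@leq_trans (n.+1 ^ m)).
    apply: leq_trans (card_monotone n m); apply/subset_leq_card/subsetP => f.
    by rewrite !inE => /andP[].
  by rewrite expnM; case: (m) => // m'; rewrite leq_exp2r.
have homoM (f : {ffun 'I_n -> 'I_m}) : {homo f : i j / i <= j} ->
    (forall p, #|[set i | f i == p]| <= t) -> f \in M.
  move=> fM ft; rewrite inE; apply/andP; split; last exact/forallP.
  by apply/forallP => i; apply/forallP => j; apply/implyP/fM.
have badM : #|[set s : 'S_n | oramsey (omatching s) <= m * t]| <=
    #|setX (setX M M) [set: bool]| * (n`! %/ 2 ^ (2 * q)).
  apply: (@union_bound _ _ _ _
    (fun x => [set s : 'S_n | [forall i, s i \in W x i]])).
    move=> s; rewrite inE /oramsey; case: ex_minnP => N /asboolP arr _ Nmt.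
    have [f [g [b [fM gM ft gt fgE]]]] := oarrows_matching c Nmt arr.
    exists (f, g, b); first by rewrite !in_setX in_setT /= !homoM.
    rewrite inE; apply/forallP => i; rewrite inE /= -(fgE i).
    by case: ifP; rewrite ?inE => ->.
  move=> [[f g] b]; rewrite !inE /= andbT => /andP[].
  move=> /andP[_ /forallP ft] /andP[_ /forallP gt].
  rewrite leq_divRL ?expn_gt0 // -[n in n`!]card_ord.
  apply: card_perm_sparse; rewrite card_ord //.
  apply: (@sparse_rows _ _ t (20 * L) f g (if b then c else ~: c)) => //.
    lia.
  move=> X Y cX cY; have /andP[] := cP X Y ltac:(lia) ltac:(lia).
  by case: b; nia.
apply: leq_trans (leq_mul badM (leqnn _)) _.
rewrite !cardsX cardsT card_bool.
have : 2 ^ q * 2 ^ q * (n`! %/ 2 ^ (2 * q)) <= n`!.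
  by rewrite -expnD addnn -mul2n mulnC leq_divM.
have : #|M| * #|M| <= 2 ^ q.
  apply: leq_trans (leq_mul cM cM) _.
  by rewrite -expnD addnn -mul2n leq_exp2l.
nia.
Qed.

(** * Logarithmic estimates and the limit *)

(** Keeps the block parameters positive for large n. Writing the truncated logarithm as k + 14, it
    reduces to k + 15 <= 16 * 2^k. *)
Lemma mul_trunc_log_leq (n : nat) :
  2 ^ 14 <= n -> 1024 * (trunc_log 2 n).+1 <= n.
Proof.
move=> n14; have n0 : 0 < n by apply: leq_trans n14; rewrite expn_gt0.
apply: leq_trans (trunc_logP (ltnSn 1) n0).
have /subnK <- := trunc_log_max (ltnSn 1) n14.
move: (_ - 14) => k; have -> : 2 ^ (k + 14) = 2 ^ 10 * (2 ^ 4 * 2 ^ k).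
  by rewrite -!expnD; congr (2 ^ _); lia.
by rewrite leq_mul //; have := ltn_expl k (ltnSn 1); lia.
Qed.

Import Order.TTheory GRing.Theory Num.Theory numFieldNormedType.Exports.
Local Open Scope ring_scope.

Lemma trunc_log_le_log2 (R : realType) (n : nat) : (0 < n)%N ->
  ((trunc_log 2 n)%:R : R) <= log2 n%:R.
Proof.
move=> n0; have ln2 : 0 < ln (2 : R) by rewrite ln_gt0 // ltr1n.
rewrite /log2 ler_pdivlMr // mulr_natl -lnXn //.
rewrite ler_ln ?posrE ?exprn_gt0 ?ltr0n //.
by rewrite -natrX ler_nat trunc_logP.
Qed.

(** The factor 4 is 2 * 2: one 2 pays for rounding down a positive quotient, the other for l + 1 <=
    2l. *)
Lemma div_log2_le (R : realType) (a n : nat) : (0 < a)%N -> (1 < n)%N ->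
  (a * (trunc_log 2 n).+1 <= n)%N ->
  (n%:R / log2 n%:R : R) <= (4 * a)%:R * (n %/ (a * (trunc_log 2 n).+1))%:R.
Proof.
move=> a0 n1 aLn; have n0 := ltnW n1.
have l0 : (0 < trunc_log 2 n)%N by rewrite trunc_log_gt0.
have le_log := trunc_log_le_log2 R n0.
move: (trunc_log 2 n) l0 le_log aLn => l l0 le_log aLn.
have log0 : 0 < log2 (n%:R : R) by apply: lt_le_trans le_log; rewrite ltr0n.
rewrite ler_pdivrMr //.
set m := (n %/ _)%N; have n_le : (n <= 4 * a * m * l)%N.
  have b0 : (0 < a * l.+1)%N by rewrite muln_gt0 a0.
  have m0 : (0 < m)%N by rewrite divn_gt0.
  have : (n < m.+1 * (a * l.+1))%N by rewrite -ltn_divLR.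
  have : (m.+1 * (a * l.+1) <= (2 * m) * (a * (2 * l)))%N.
    by rewrite !leq_mul //; lia.
  by lia.
apply: (@le_trans _ _ ((4 * a)%:R * m%:R * l%:R)).
  by rewrite -!natrM ler_nat.
by rewrite ler_wpM2l // mulr_ge0.
Qed.

Theorem theorem3p5 (R : realType) :
  exists C : R, 0 < C /\
    aas R (fun n : nat =>
      [set s : 'S_n |
        C * (n%:R / log2 (n%:R : R)) ^+ 2 <= (oramsey (omatching s))%:R]).
Proof.
(* The two factors are the losses of [div_log2_le] at a = 1024 for m and at a = 40 for t. *)
exists ((4 * 1024)%:R * (4 * 40)%:R)^-1; split.
  by rewrite invr_gt0 mulr_gt0 ?ltr0n.
rewrite /aas.
(* The failure probability is at most 2/2^q, weakened to 2/(q + 1), twice the harmonic sequence at q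
   = [n %/ 512]. *)
apply: (@squeeze_cvgr nat _ _ R
  (fun n => 1 - 2 * harmonic (n %/ 512)%N) (fun=> 1)).
- have := nbhs_infty_ge (2 ^ 14)%N.
  apply: filterS => n /[dup] n14 /mul_trunc_log_leq.
  set L := (trunc_log 2 n).+1 => Ln.
  have L40n : (40 * L <= n)%N by rewrite (leq_trans _ Ln) // leq_mul2r orbT.
  set A := [set s | _]; rewrite /uniform_Pr.
  have n1 : (1 < n)%N by lia.
  rewrite card_Sn; have nf0 : 0 < (n`!%:R : R) by rewrite ltr0n fact_gt0.
  apply/andP; split; last first.
    by rewrite ler_pdivrMr // mul1r ler_nat -card_Sn max_card.
  set q := (n %/ 512)%N.
  (* 1024 = 2 * 512 gives 2Lm <= q. *)
  pose m := (n %/ (1024 * L))%N; pose t := (n %/ (40 * L))%N.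
  have bad : (#|[set s : 'S_n | (oramsey (omatching s) <= m * t)%N]| * 2 ^ q
               <= 2 * n`!)%N.
    apply: (@few_small_oramsey n q m t L) => //.
    + by rewrite trunc_log_ltn.
    + by rewrite mulnC leq_divM.
    + rewrite leq_divRL // (leq_trans _ (leq_divM n (1024 * L))) // -/m; lia.
    + by rewrite mulnC leq_divM.
  have compl : ~: A \subset [set s : 'S_n | (oramsey (omatching s) <= m * t)%N].
    apply/subsetP => s; rewrite !inE; apply: contraNT.
    rewrite -ltnNge => /ltnW mt.
    rewrite mulrC ler_pdivrMr ?mulr_gt0 ?ltr0n //.
    apply: (@le_trans _ _ ((m * t)%:R * ((4 * 1024)%:R * (4 * 40)%:R)));
      last first.
      by rewrite ler_wpM2r ?ler_nat // mulr_ge0.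
    have log0 : 0 <= log2 (n%:R : R).
      exact: le_trans (ler0n _ _) (trunc_log_le_log2 R (ltnW n1)).
    have y0 : 0 <= n%:R / log2 (n%:R : R) by rewrite divr_ge0.
    have Lm := @div_log2_le R 1024 n isT n1 Ln.
    have Lt := @div_log2_le R 40 n isT n1 L40n.
    rewrite expr2; apply: le_trans (ler_pM y0 y0 Lm Lt) _.
    by rewrite [(m * t)%:R]natrM mulrACA mulrC.
  have {compl} bad2 : (#|~: A| * q.+1 <= 2 * n`!)%N.
    apply: leq_trans bad; apply: leq_mul; first exact: subset_leq_card.
    exact: ltn_expl.
  rewrite ler_pdivlMr // mulrBl mul1r lerBlDr /=.
  have cA : n`! = (#|A| + #|~: A|)%N by rewrite cardsC card_Sn.
  rewrite {1}cA natrD lerD2l.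
  rewrite mulrAC ler_pdivlMr ?ltr0n //.
  by rewrite -!natrM ler_nat.
- have -> : nbhs (1 : R) = nbhs (1 - 2 * 0 : R) by rewrite mulr0 subr0.
  apply: cvgB; first exact: cvg_cst.
  apply: cvgMl_tmp.
  exact: (cvg_comp _ _ (@cvg_divnr 512 isT) cvg_harmonic).
- exact: cvg_cst.
Qed.
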